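(* Let $\epsilon>0$. For every function $y_0:[\epsilon,3\epsilon)\to\mathbb{R}$ there is a unique function $y:[0,\infty)\to\mathbb{R}$ such that $y(3x)=y(x)+y(2x)$ for all $x\in[0,\infty)$ and $y(x)=y_0(x)$ for all $x\in[\epsilon,3\epsilon)$.
   Context: No continuity is assumed. *)

(* Defs.v *)
From mathcomp Require Import all_boot all_order all_algebra.
From mathcomp Require Import reals interval_inference.

(* Main.v *)
(** Outside the window [eps, 3 eps) the equation can be solved for one value:
    y(t) = y(3t) - y(2t) below it, and y(t) = y(t/3) + y(2t/3) above it. The
    arguments on the right lie in the window or strictly nearer to it, by a
    factor of at least 2 (resp. 3/2), and never jump past it. So every t > 0
    reaches the window in boundedly many steps, and y(0) = 0 is forced. *)
Require Import Defs.
From mathcomp Require Import all_boot all_order all_algebra.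
From mathcomp Require Import reals interval_inference.
From mathcomp Require Import boolp lra.
Import Order.TTheory GRing.Theory Num.Theory.
Local Open Scope ring_scope.

(** Bernoulli's inequality [n * (b - 1) < b ^ n] and the Archimedean property. Asking for all later
    exponents lets two thresholds be met together at their maximum. *)
Lemma ltr_exp_bound (R : realType) (b x : R) :
  1 < b -> exists n, forall m, (n <= m)%N -> x < b ^+ m.
Proof.
move=> b1; have c0 : 0 < b - 1 by rewrite subr_gt0.
have bernoulli n : n%:R * (b - 1) < b ^+ n.
  elim: n => [|n IHn]; first by rewrite mul0r expr0.
  have : 1 <= b ^+ n by apply: exprn_ege1; exact: ltW.
  rewrite exprS -natr1; nra.
exists (Num.bound `|x / (b - 1)|) => m le_m.
apply: le_lt_trans (bernoulli m); rewrite -ler_pdivrMr//.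
apply: le_trans (ler_norm _) _.
by apply: le_trans (ltW (archi_boundP _)) _; rewrite ?ler_nat.
Qed.

Lemma window_ind (R : realType) (eps : R) (P : R -> Prop) :
    0 < eps ->
    (forall t, eps <= t < 3 * eps -> P t) ->
    (forall t, 0 < t < eps -> P (3 * t) -> P (2 * t) -> P t) ->
    (forall t, 3 * eps <= t -> P (t / 3) -> P (2 * (t / 3)) -> P t) ->
  forall t, 0 < t -> P t.
Proof.
move=> e0 Pmid Pdown Pup t t0.
(* The intervals [[eps / 2^n, 3 eps (3/2)^n)] exhaust the positive reals. From stage [n + 1], a
   point below the window has [2s] and [3s] in stage [n], and a point above it has [s/3] and [2s/3]
   there. *)
have reach n s : 0 < s -> eps <= s * 2 ^+ n -> s < 3 * eps * (3 / 2) ^+ n -> P s.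
  elim: n s => [|n IHn] s s0; rewrite ?expr0 ?mulr1 => lo hi.
    by apply: Pmid; rewrite lo.
  have p2 : 1 <= 2 ^+ n :> R by apply: exprn_ege1; lra.
  have p32 : 1 <= (3 / 2) ^+ n :> R by apply: exprn_ege1; lra.
  move: lo hi; rewrite !exprS => lo hi.
  have [lt_se|le_es] := ltP s eps.
    by apply: Pdown; rewrite ?s0//; apply: IHn; nra.
  have [lt_s3|le_3s] := ltP s (3 * eps); first by apply: Pmid; rewrite le_es.
  by apply: Pup => //; apply: IHn; nra.
have [n ltn] : exists n, forall m, (n <= m)%N -> eps / t < 2 ^+ m.
  by apply: ltr_exp_bound; lra.
have [k ltk] : exists k, forall m, (k <= m)%N -> t / (3 * eps) < (3 / 2) ^+ m.
  by apply: ltr_exp_bound; lra.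
apply: (reach (maxn n k)) => //.
  by rewrite mulrC -ler_pdivrMr// ltW// ltn// leq_maxl.
by rewrite mulrC -ltr_pdivrMr ?ltk ?leq_maxr//; lra.
Qed.

(* [n] is fuel; the value 0 on running out is junk, except at [t = 0], where the
   fuel always runs out and 0 is the value forced by the equation. *)
Fixpoint window_rec (R : realType) (eps : R) (g : R -> R) (n : nat) (t : R) : R :=
  if eps <= t < 3 * eps then g t else
  if n is m.+1 then
    if t < eps then window_rec R eps g m (3 * t) - window_rec R eps g m (2 * t)
    else window_rec R eps g m (t / 3) + window_rec R eps g m (2 * (t / 3))
  else 0.

Lemma window_rec_mid (R : realType) (eps : R) (g : R -> R) n t :
  eps <= t < 3 * eps -> window_rec R eps g n t = g t.
Proof. by case: n => [|n] /= ->. Qed.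

Lemma window_recS_down (R : realType) (eps : R) (g : R -> R) n t :
  t < eps ->
  window_rec R eps g n.+1 t =
    window_rec R eps g n (3 * t) - window_rec R eps g n (2 * t).
Proof. by move=> lt_te /=; rewrite lt_te leNgt lt_te. Qed.

Lemma window_recS_up (R : realType) (eps : R) (g : R -> R) n t :
    0 < eps -> 3 * eps <= t ->
  window_rec R eps g n.+1 t =
    window_rec R eps g n (t / 3) + window_rec R eps g n (2 * (t / 3)).
Proof.
move=> eps_gt0 le_t /=; rewrite [t < 3 * eps]ltNge le_t andbF.
by have /negbTE -> : ~~ (t < eps) by rewrite -leNgt; lra.
Qed.

Lemma window_rec0 (R : realType) (eps : R) (g : R -> R) n :
  0 < eps -> window_rec R eps g n 0 = 0.
Proof.
move=> eps_gt0; case: n => [|n]; last by rewrite window_recS_down// !mulr0 subrr.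
by rewrite /= leNgt eps_gt0.
Qed.

(** Removes the fuel: one unit more than suffices for both recursive arguments suffices for [t]. The
    eventual value [v] will serve as [y(t)]. *)
Lemma window_rec_stable (R : realType) (eps : R) (g : R -> R) t :
  0 < eps -> 0 <= t ->
  exists v, exists n, forall m, (n <= m)%N -> window_rec R eps g m t = v.
Proof.
move=> eps_gt0; rewrite le_eqVlt => /predU1P[<-|].
  by exists 0, 0%N => m _; exact: window_rec0.
move: t; apply: (window_ind R eps) => //= t ht.
- by exists (g t), 0%N => m _; exact: window_rec_mid.
- move=> [v [n nv]] [w [k kw]]; exists (v - w), (maxn n k).+1.
  case=> // m; rewrite ltnS geq_max => /andP[nm km].
  by case/andP: ht => _ ht; rewrite window_recS_down// nv// kw.
- move=> [v [n nv]] [w [k kw]]; exists (v + w), (maxn n k).+1.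
  case=> // m; rewrite ltnS geq_max => /andP[nm km].
  by rewrite window_recS_up// nv// kw.
Qed.

Lemma window_extension_exists (R : realType) (eps : R) (g : R -> R) :
    0 < eps ->
  exists y : {nonneg R} -> R,
    (forall x : {nonneg R},
        y (3 * x%:num)%:nng = y x + y (2 * x%:num)%:nng)
    /\ (forall x : {nonneg R}, eps <= x%:num < 3 * eps -> y x = g x%:num).
Proof.
move=> eps_gt0; have /choice[y yP] : forall x : {nonneg R},
    exists v, exists n, forall m, (n <= m)%N -> window_rec R eps g m x%:num = v.
  by move=> x; exact: window_rec_stable.
exists y; split=> [x|x xI]; last first.
  by have [n yn] := yP x; rewrite -(yn n)// window_rec_mid.
have [i yi] := yP x; have [j yj] := yP (2 * x%:num)%:nng.
have [k yk] := yP (3 * x%:num)%:nng; pose n := (i + j + k)%N.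
have [ni nj nk] : [/\ (i <= n)%N, (j <= n)%N & (k <= n)%N].
  by rewrite /n -addnA leq_addr addnCA leq_addr addnA leq_addl.
(* Fuel [n] is enough at [x], [2x] and [3x] alike. For [x < eps] the equation is the downward clause
   unfolded at [x]; otherwise [3x] lies above the window and it is the upward clause unfolded at
   [3x]. *)
have [lt_xe|le_ex] := ltP x%:num eps.
  have := yi n.+1 (leqW ni); rewrite window_recS_down// (yk n)// (yj n)//.
  by move=> <-; rewrite subrK.
have x3 : 3 * x%:num / 3 = x%:num :> R by rewrite mulrAC divff ?mul1r.
have := yk n.+1 (leqW nk); rewrite [_%:num]/= window_recS_up ?ler_pM2l// x3.
by rewrite (yi n)// (yj n).
Qed.

Lemma window_extension_unique (R : realType) (eps : R) (y z : {nonneg R} -> R) :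
    0 < eps ->
    (forall x, y (3 * x%:num)%:nng = y x + y (2 * x%:num)%:nng) ->
    (forall x, z (3 * x%:num)%:nng = z x + z (2 * x%:num)%:nng) ->
    (forall x : {nonneg R}, eps <= x%:num < 3 * eps -> y x = z x) ->
  y = z.
Proof.
move=> eps_gt0 yE zE yz.
(* At 0 the three arguments coincide, so the equation reads [f 0 = f 0 + f 0]. *)
have val0 (f : {nonneg R} -> R) x : x%:num = 0 ->
    f (3 * x%:num)%:nng = f x + f (2 * x%:num)%:nng -> f x = 0.
  move=> x0.
  have -> : (3 * x%:num)%:nng = x by apply/val_inj; rewrite /= x0 mulr0.
  have -> : (2 * x%:num)%:nng = x by apply/val_inj; rewrite /= x0 mulr0.
  lra.
apply/funext => x.
have : 0 <= x%:num by []; rewrite le_eqVlt => /predU1P[/esym x0|].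
  by rewrite (val0 y)// (val0 z).
move tE : x%:num => t t0.
elim/(window_ind R eps): t / t0 x tE => // t ht.
- by move=> x xt; apply: yz; rewrite xt.
(* Adding [y(2x)] to both sides turns the left one into [y(3x)], where the induction hypothesis
   applies. *)
- move=> IH3 IH2 x xt; apply: (addIr (y (2 * x%:num)%:nng)).
  rewrite -yE (IH3 (3 * x%:num)%:nng) /= ?xt//.
  by rewrite (IH2 (2 * x%:num)%:nng) /= ?xt// zE.
- move=> IH1 IH2 x xt.
  have t3 : 3 * (x%:num / 3) = x%:num :> R by rewrite mulrCA divff ?mulr1.
  (* Writing [x] as [3 (x/3)] exposes the left side of the equation at [x/3]. *)
  have -> : x = (3 * (x%:num / 3)%:nng%:num)%:nng by apply/val_inj; rewrite /= t3.
  by rewrite yE zE (IH1 (x%:num / 3)%:nng) ?(IH2 (2 * _)%:nng) /= ?xt.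
Qed.

Theorem theorem5p3 (R : realType) (eps : R) (eps_gt0 : 0 < eps)
    (y0 : {x : R | eps <= x < 3 * eps} -> R) :
  exists! y : {nonneg R} -> R,
    (forall x : {nonneg R},
        y (3 * x%:num)%:nng = y x + y (2 * x%:num)%:nng)
    /\ (forall (x : {nonneg R}) (xI : eps <= x%:num < 3 * eps),
           y x = y0 (exist _ x%:num xI)).

Proof.
(* [y0] made total; the default 0 outside the window is never read, since [window_rec] evaluates [g]
   only inside it. *)
pose g t := oapp y0 0 (insub t).
have gE t tI : g t = y0 (exist _ t tI) by rewrite /g insubT.
have [y [yE yg]] := window_extension_exists R eps g eps_gt0.
exists y; split=> [|z [zE zy0]].
  by split=> // x xI; rewrite yg.
apply: (window_extension_unique R eps) => // x xI.
by rewrite yg// zy0.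
Qed.
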